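(* Let $A,B\in M_{d}^{+}$ and $0\leq v\leq 1$. Then $$A\nabla_{v}B\ \geq\ A\sharp_{v}B+r_{0}(v)(A+B-2A\sharp B)+\alpha(v)\,A\sharp_{f_{\min}}B$$ and $$A\nabla_{v}B\ \leq\ A+B-A\sharp_{1-v}B-r_{0}(v)(A+B-2A\sharp B)-\alpha(v)\,A\sharp_{f_{\min}}B$$ $$=\ 2A\sharp B-A\sharp_{1-v}B+R_{0}(v)(A+B-2A\sharp B)-\alpha(v)\,A\sharp_{f_{\min}}B,$$ where $\alpha(v)=\frac12v(1-v)-\frac14r_{0}(v)$ and $f_{\min}(x)=\min\{1,x\}(\ln x)^{2}$ for $x>0$.
   Context: $M_d^+$ is the set of $d\times d$ complex positive definite matrices. For Hermitian matrices, $A\le B$ means $B-A$ is positive semidefinite. $r_0(v)=\min\{v,1-v\}$ and $R_0(v)=1-r_0(v)$. For $A,B\in M_d^+$ and $0\le v\le1$: $A\nabla_vB=(1-v)A+vB$, $A\sharp_vB=A^{1/2}(A^{-1/2}BA^{-1/2})^vA^{1/2}$, and $A\sharp B=A\sharp_{1/2}B$. For a continuous function $f$ on an interval containing the spectrum of $A^{-1/2}BA^{-1/2}$, $A\sharp_fB=A^{1/2}f(A^{-1/2}BA^{-1/2})A^{1/2}$, where $f(\cdot)$ is given by the continuous functional calculus. *)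

(* Defs.v *)
From mathcomp Require Export all_boot all_order all_algebra.
From mathcomp Require Export reals exp.
From mathcomp Require Export complex.

Set Implicit Arguments.
Unset Strict Implicit.
Unset Printing Implicit Defensive.

Import Order.TTheory GRing.Theory Num.Theory.
Local Open Scope ring_scope.
Local Open Scope sesquilinear_scope.
Local Open Scope complex_scope.

Section MatrixMeans.
Variables (R : realType) (d : nat).
Implicit Types (A B : 'M[R[i]]_d) (v : R) (f : R -> R).

(* In R[i], 0 < z (resp. 0 <= z) includes the assertion that z is real. *)
Definition posdef A : Prop :=
  A \is hermsymmx /\
  forall x : 'cV[R[i]]_d, x != 0 -> 0 < (x ^t* *m A *m x) 0 0.

Definition possemidef A : Prop :=
  A \is hermsymmx /\ forall x : 'cV[R[i]]_d, 0 <= (x ^t* *m A *m x) 0 0.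

Definition loewner_le A B : Prop := possemidef (B - A).

(* Continuous functional calculus: writing the Hermitian matrix A as
   U^-1 diag(a_1, ..., a_d) U with U unitary and a_i real, f(A) is
   U^-1 diag(f(a_1), ..., f(a_d)) U.  [complex.Re] only retypes the eigenvalues
   as elements of R, so this is meaningful for Hermitian A; the values of f
   outside the spectrum of A are irrelevant. *)
Definition mxfun f A : 'M[R[i]]_d :=
  invmx (spectralmx A)
  *m diag_mx (map_mx (fun z : R[i] => (f (complex.Re z))%:C) (spectral_diag A))
  *m spectralmx A.

Definition mxpow A (p : R) : 'M[R[i]]_d := mxfun (fun x => x `^ p) A.

(* A^{-1/2} B A^{-1/2} *)
Definition relmx A B : 'M[R[i]]_d :=
  mxpow A (- 2^-1) *m B *m mxpow A (- 2^-1).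

Definition amean v A B : 'M[R[i]]_d := (1 - v)%:C *: A + v%:C *: B.

Definition gmean v A B : 'M[R[i]]_d :=
  mxpow A 2^-1 *m mxpow (relmx A B) v *m mxpow A 2^-1.

Definition fmean f A B : 'M[R[i]]_d :=
  mxpow A 2^-1 *m mxfun f (relmx A B) *m mxpow A 2^-1.

End MatrixMeans.

Section Weights.
Variable R : realType.

Definition r0 (v : R) : R := Num.min v (1 - v).
Definition R0 (v : R) : R := 1 - r0 v.
Definition alpha (v : R) : R := 2^-1 * v * (1 - v) - 4^-1 * r0 v.
Definition fmin (x : R) : R := Num.min 1 x * (ln x) ^+ 2.

End Weights.

(* Main.v *)
Require Import Defs.
From mathcomp Require Import classical_sets sequences topology normedtype derive.
From mathcomp Require Import realfun.
From mathcomp Require Import ring lra.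

(** Everything reduces to one inequality between functions of a real variable
    [x > 0],

      x^v + r0(v) (1 + x - 2 sqrt x) + alpha(v) fmin(x) <= (1 - v) + v x.

    For positive definite [A] and [B], [f |-> fmean f A B] is real-linear, it
    sends the constant 1 to [A] and the identity to [B] ([fmean_cst1],
    [fmean_id]), and it is monotone, since the relative matrix
    A^(-1/2) B A^(-1/2) has positive eigenvalues and congruence preserves
    positive semidefiniteness ([loewner_fmean]).  Applying it to the two sides
    of the scalar inequality gives the lower bound on the weighted arithmetic
    mean.  The upper bound is the lower bound at weight [1 - v]: [r0] and
    [alpha] are invariant under [v |-> 1 - v], and the arithmetic means of
    weights [v] and [1 - v] add up to [A + B].  The final equality only uses
    [R0 = 1 - r0].

    For the scalar inequality ([refined_young_fmin]) the starting point is the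
    quantitative convexity of the exponential,

      (1 - w) + w e^s - e^(w s) >= w (1 - w) / 2 * s^2 * min(1, e^s),

    which expresses that [exp'' >= min(1, e^s)] between 0 and [s].  Subtracting
    [r0(v) (1 + x - 2 sqrt x)] from [1 - v + v x] leaves a weighted mean of
    [1] and [sqrt x] with weight [w = 2 v] when [v <= 1/2], and [sqrt x] times
    such a mean with weight [w = 2 v - 1] when [v >= 1/2].  So the convexity
    estimate ([young_expR]) applies at [s = (ln x) / 2], and in both cases
    [w (1 - w) / 2 * s^2] equals [alpha(v) (ln x)^2].  The error factor it
    provides, [min(1, sqrt x)] or [sqrt x * min(1, sqrt x)], is at least
    [min(1, x)] ([min1_expR_half]). *)

Set Implicit Arguments.
Unset Strict Implicit.
Unset Printing Implicit Defensive.

Import Order.TTheory GRing.Theory Num.Theory.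
Import numFieldNormedType.Exports.
Local Open Scope ring_scope.
Local Open Scope sesquilinear_scope.
Local Open Scope complex_scope.

(** * The scalar inequality *)

Section ScalarInequality.
Variable R : realType.
Implicit Types (s t v w x : R).

(** The gap function [h] vanishes at 0, and its derivative is
    [w (e^(w t) (e^((1 - w) t) - 1) - (1 - w) t)], which is nonnegative for
    [t >= 0] because [e^(w t) >= 1] and [e^y >= 1 + y]. *)
Lemma young_expR_ge0 w s : 0 <= w <= 1 -> 0 <= s ->
  expR (w * s) + 2^-1 * w * (1 - w) * s ^+ 2 <= 1 - w + w * expR s.
Proof.
move=> /andP[w0 w1] s0.
pose h t : R := 1 - w + w * expR t - expR (w * t) - 2^-1 * w * (1 - w) * t ^+ 2.
have h'E t : is_derive t 1 h (w * (expR t - expR (w * t) - (1 - w) * t)).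
  rewrite /h; apply: is_derive_eq.
  by rewrite /GRing.scale /=; field.
have h0 : h 0 = 0 by rewrite /h mulr0 expR0; ring.
suff : h 0 <= h s by rewrite h0 /h; lra.
apply: (@ger0_derive1_ndecry _ h 0) => //.
- move=> t; rewrite in_itv /= andbT => t0.
  rewrite derive1E derive_val mulr_ge0//.
  have -> : expR t = expR (w * t) * expR ((1 - w) * t).
    by rewrite -expRD; congr expR; ring.
  have e1 : 1 <= expR (w * t) by rewrite -expR0 ler_expR mulr_ge0// ltW.
  have e2 := expR_ge1Dx ((1 - w) * t).
  have wt : 0 <= (1 - w) * t by rewrite mulr_ge0// ?subr_ge0// ltW.
  nra.
- by apply: derivable_within_continuous => t _; exact: ex_derive.
Qed.

(** The case [s < 0] is the case [- s > 0] with weight [1 - w], multiplied by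
    e^s, which is then equal to [min(1, e^s)]. *)
Lemma young_expR w s : 0 <= w <= 1 ->
  expR (w * s) + 2^-1 * w * (1 - w) * s ^+ 2 * Num.min 1 (expR s)
    <= 1 - w + w * expR s.
Proof.
move=> /andP[w0 w1]; have [s0|s0] := leP 0 s.
  rewrite min_l; last by rewrite -expR0 ler_expR.
  by rewrite mulr1 young_expR_ge0// w0.
rewrite min_r; last by rewrite -expR0 ler_expR ltW.
have /(ler_wpM2r (expR_ge0 s)) :=
  @young_expR_ge0 (1 - w) (- s) ltac:(lra) ltac:(lra).
rewrite mulrDl -expRD (_ : (1 - w) * - s + s = w * s); last by ring.
have : expR (- s) * expR s = 1 by rewrite -expRD addNr expR0.
rewrite sqrrN; nra.
Qed.

(** With [y = e^(s/2)] this compares [min(1, y^2)] to [min(1, y)] and to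
    [y min(1, y) = min(y, y^2)]; these two are the error factors that occur for
    weights below and above 1/2. *)
Lemma min1_expR_half s :
  Num.min 1 (expR s) <= Num.min 1 (expR (2^-1 * s)) /\
  Num.min 1 (expR s) <= expR (2^-1 * s) * Num.min 1 (expR (2^-1 * s)).
Proof.
have -> : expR s = expR (2^-1 * s) * expR (2^-1 * s).
  by rewrite -expRD; congr expR; field.
have e0 := expR_gt0 (2^-1 * s).
have [e1|e1] := leP 1 (expR (2^-1 * s)).
- by rewrite min_l; [split|]; nra.
- by rewrite min_r; [split|]; nra.
Qed.

Lemma refined_young_fmin v x : 0 <= v <= 1 -> 0 < x ->
  x `^ v + r0 v * (1 + x - 2 * x `^ 2^-1) + alpha v * fmin x <= 1 - v + v * x.
Proof.
move=> /andP[v0 v1] x0; rewrite /fmin.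
have : x = expR (ln x) by rewrite lnK.
move: (ln x) => t {x0}->.
rewrite -!expRM.
have [m1 m2] := min1_expR_half t.
set m := Num.min 1 (expR t) in m1 m2 *.
set n := Num.min 1 (expR (2^-1 * t)) in m1 m2 *.
have t2 := sqr_ge0 t.
rewrite /alpha /r0 [t * 2^-1]mulrC; have [vh|vh] := leP v (1 - v).
(* Here [r0 v = v]; moving its term to the right leaves there the mean of 1
   and e^(t/2) of weight [2 v]. *)
- have := @young_expR (2 * v) (2^-1 * t) ltac:(lra); rewrite -/n.
  rewrite (_ : 2 * v * (2^-1 * t) = t * v); last by field.
  have : 0 <= v * (1 - 2 * v) * t ^+ 2 by rewrite mulr_ge0// mulr_ge0//; lra.
  by move/ler_wpM2l => /(_ _ _ m1); lra.
(* Here [r0 v = 1 - v]; moving its term to the right leaves there e^(t/2) times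
   the mean of 1 and e^(t/2) of weight [2 v - 1]. *)
- have := @young_expR (2 * v - 1) (2^-1 * t) ltac:(lra); rewrite -/n.
  move/(ler_wpM2l (expR_ge0 (2^-1 * t))).
  rewrite !mulrDr -expRD.
  rewrite (_ : 2^-1 * t + (2 * v - 1) * (2^-1 * t) = t * v); last by field.
  rewrite [expR _ * (_ * expR _)]mulrCA -expRD.
  rewrite (_ : 2^-1 * t + 2^-1 * t = t); last by field.
  have : 0 <= (2 * v - 1) * (1 - v) * t ^+ 2 by rewrite mulr_ge0// mulr_ge0//; lra.
  by move/ler_wpM2l => /(_ _ _ m2); lra.
Qed.

End ScalarInequality.

(** * Conjugates of diagonal matrices *)

Section DiagonalConjugates.
Variables (K : comUnitRingType) (n : nat) (U : 'M[K]_n).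
Implicit Types e : 'rV[K]_n.

Definition conj_diag e : 'M[K]_n := invmx U *m diag_mx e *m U.

Lemma conj_diagM e1 e2 : U \in unitmx ->
  conj_diag e1 *m conj_diag e2 = conj_diag (\row_j (e1 0 j * e2 0 j)).
Proof.
move=> uU; rewrite /conj_diag !mulmxA mulmxK//; congr (_ *m _).
by rewrite -!mulmxA mulmx_diag.
Qed.

Lemma conj_diagD e1 e2 : conj_diag e1 + conj_diag e2 = conj_diag (e1 + e2).
Proof. by rewrite /conj_diag -mulmxDl -mulmxDr -raddfD. Qed.

Lemma conj_diagZ c e : c *: conj_diag e = conj_diag (c *: e).
Proof. by rewrite /conj_diag scalemxAl scalemxAr -linearZ. Qed.

Lemma conj_diag1 : U \in unitmx -> conj_diag (const_mx 1) = 1%:M.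
Proof. by move=> uU; rewrite /conj_diag diag_const_mx mulmx1 mulVmx. Qed.

End DiagonalConjugates.

(** * Congruence and functional calculus for complex matrices *)

Section Adjoint.
Variable C : numClosedFieldType.

Lemma trmxC_mul m n p (A : 'M[C]_(m, n)) (B : 'M[C]_(n, p)) :
  (A *m B) ^t* = B ^t* *m A ^t*.
Proof. by rewrite trmx_mul map_mxM. Qed.

Lemma hermsymmxP n (A : 'M[C]_n) : reflect (A ^t* = A) (A \is hermsymmx).
Proof.
by apply: (iffP (is_hermitianmxP _ _ _)); rewrite expr0 scale1r => /esym.
Qed.

End Adjoint.

Section Matrices.
Variables (R : realType) (d : nat).
Implicit Types (A B P M : 'M[R[i]]_d) (f g : R -> R).

Lemma possemidef_congr P M : possemidef M -> possemidef (P ^t* *m M *m P).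
Proof.
move=> [/hermsymmxP hM M0]; split.
  by apply/hermsymmxP; rewrite !trmxC_mul trmxCK hM mulmxA.
by move=> x; have := M0 (P *m x); rewrite trmxC_mul !mulmxA.
Qed.

Lemma posdef_congr P M : P \in unitmx -> posdef M -> posdef (P ^t* *m M *m P).
Proof.
move=> uP [/hermsymmxP hM M0]; split.
  by apply/hermsymmxP; rewrite !trmxC_mul trmxCK hM mulmxA.
move=> x x0; have := M0 (P *m x); rewrite trmxC_mul !mulmxA; apply.
by apply: contra_neq x0 => /(congr1 (mulmx (invmx P))); rewrite mulKmx ?mulmx0.
Qed.

Lemma mxfunE f A : mxfun f A =
  conj_diag (spectralmx A) (\row_j (f (complex.Re (spectral_diag A 0 j)))%:C).
Proof.
suff -> : \row_j (f (complex.Re (spectral_diag A 0 j)))%:C =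
    map_mx (fun z : R[i] => (f (complex.Re z))%:C) (spectral_diag A) by [].
by apply/rowP => j; rewrite !mxE.
Qed.

Lemma eq_mxfun f g A : f =1 g -> mxfun f A = mxfun g A.
Proof.
move=> fg; rewrite !mxfunE; congr (conj_diag _ _).
by apply/rowP => j; rewrite !mxE fg.
Qed.

Lemma mxfunM f g A : mxfun f A *m mxfun g A = mxfun (fun x => f x * g x) A.
Proof.
rewrite !mxfunE conj_diagM; last exact: spectral_unit.
congr (conj_diag _ _).
by apply/rowP => j; rewrite !mxE rmorphM.
Qed.

Lemma mxfunD f g A : mxfun f A + mxfun g A = mxfun (fun x => f x + g x) A.
Proof.
rewrite !mxfunE conj_diagD; congr (conj_diag _ _).
by apply/rowP => j; rewrite !mxE rmorphD.
Qed.

Lemma mxfunZ c f A : c%:C *: mxfun f A = mxfun (fun x => c * f x) A.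
Proof.
rewrite !mxfunE conj_diagZ; congr (conj_diag _ _).
by apply/rowP => j; rewrite !mxE rmorphM.
Qed.

Lemma mxfun_cst1 A : mxfun (fun=> 1) A = 1%:M.
Proof.
rewrite mxfunE -(conj_diag1 (spectral_unit A)); congr (conj_diag _ _).
by apply/rowP => j; rewrite !mxE.
Qed.

Lemma mxfun_id A : A \is hermsymmx -> mxfun id A = A.
Proof.
move=> hA; rewrite [RHS](orthomx_spectralP (hermitian_normalmx hA)) mxfunE.
rewrite -[RHS]/(conj_diag _ _); congr (conj_diag _ _).
apply/rowP => j; rewrite mxE RRe_real//.
exact: (mxOverP (hermitian_spectral_diag_real hA)).
Qed.

Lemma mxfun_adj f A : (mxfun f A) ^t* = mxfun f A.
Proof.
rewrite !mxfunE /conj_diag invmx_unitary ?spectral_unitarymx//.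
rewrite !trmxC_mul trmxCK mulmxA tr_diag_mx map_diag_mx.
set e1 := (X in diag_mx X); set e2 := \row_j _.
have -> : e1 = e2; last by [].
by apply/rowP => j; rewrite !mxE; apply/CrealP/complex_realP; eexists.
Qed.

(** The [j]-th eigenvalue is the value of the quadratic form of [A] at the
    [j]-th column of the adjoint of the diagonalizing unitary matrix. *)
Lemma posdef_spectral_gt0 A j : posdef A -> 0 < complex.Re (spectral_diag A 0 j).
Proof.
move=> [hA A0].
suff : 0 < spectral_diag A 0 j by rewrite ltcE => /andP[].
pose U := spectralmx A; pose x : 'cV_d := U ^t* *m delta_mx j 0.
have uU : U *m U ^t* = 1%:M by apply/unitarymxP/spectral_unitarymx.
have xtU : x ^t* *m U ^t* = delta_mx 0 j.
  by rewrite trmxC_mul trmxCK -mulmxA uU mulmx1 trmx_delta map_delta_mx.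
have Ux : U *m x = delta_mx j 0 by rewrite mulmxA uU mul1mx.
have /A0 : x != 0.
  apply/eqP => x0; have /matrixP/(_ j 0) := Ux.
  by rewrite x0 mulmx0 !mxE !eqxx => /esym/eqP; rewrite oner_eq0.
rewrite {1}(orthomx_spectralP (hermitian_normalmx hA)).
rewrite invmx_unitary ?spectral_unitarymx// -/U !mulmxA xtU.
rewrite -(mulmxA _ U) uU mulmx1.
by rewrite -rowE -colE !mxE eqxx.
Qed.

Lemma posdef_eq_mxfun f g A : posdef A -> (forall x, 0 < x -> f x = g x) ->
  mxfun f A = mxfun g A.
Proof.
move=> pA fg; rewrite !mxfunE; congr (conj_diag _ _).
by apply/rowP => j; rewrite !mxE fg// posdef_spectral_gt0.
Qed.

(** If [g] is the square root of [f], then [f(A) = g(A)^* 1 g(A)] is a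
    congruence of the identity. *)
Lemma mxfun_possemidef f A : posdef A -> (forall x, 0 < x -> 0 <= f x) ->
  possemidef (mxfun f A).
Proof.
move=> pA f0; rewrite
  (@posdef_eq_mxfun f (fun x => Num.sqrt (f x) * Num.sqrt (f x)))//; last first.
  by move=> x x0; rewrite -expr2 sqr_sqrtr ?f0.
rewrite -mxfunM -{1}mxfun_adj -[X in X *m _]mulmx1.
apply: possemidef_congr; split; first by apply/hermsymmxP; rewrite trmx1 map_mx1.
move=> x; rewrite mulmx1 mxE; apply: sumr_ge0 => j _.
by rewrite !mxE mulrC mul_conjC_ge0.
Qed.

Lemma mxpowD A p q : posdef A -> mxpow A p *m mxpow A q = mxpow A (p + q).
Proof.
move=> pA; rewrite /mxpow mxfunM; apply: posdef_eq_mxfun => // x x0.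
by rewrite powRD// (gt_eqF x0) implybT.
Qed.

Lemma mxpow_adj A p : (mxpow A p) ^t* = mxpow A p.
Proof. exact: mxfun_adj. Qed.

Lemma mxpow0 A : mxpow A 0 = 1%:M.
Proof.
by rewrite -(mxfun_cst1 A); apply: eq_mxfun => x; rewrite powRr0.
Qed.

Lemma mxpow1 A : posdef A -> mxpow A 1 = A.
Proof.
move=> pA; rewrite -[RHS]mxfun_id; last by case: pA.
by apply: posdef_eq_mxfun => // x /ltW x0; rewrite powRr1.
Qed.

Lemma mxpow_unit A p : posdef A -> mxpow A p \in unitmx.
Proof.
move=> pA; have := mxpowD p (- p) pA; rewrite subrr mxpow0.
by move=> /mulmx1_unit[uA _]; exact: uA.
Qed.

Lemma relmx_posdef A B : posdef A -> posdef B -> posdef (relmx A B).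
Proof.
by move=> pA pB; rewrite /relmx -{1}mxpow_adj; apply/posdef_congr/pB/mxpow_unit.
Qed.

End Matrices.

(** * Means as a linear and monotone calculus *)

Section Means.
Variables (R : realType) (d : nat).
Implicit Types (A B : 'M[R[i]]_d) (f g : R -> R).

Lemma eq_fmean f g A B : f =1 g -> fmean f A B = fmean g A B.
Proof. by move=> fg; rewrite /fmean (eq_mxfun _ fg). Qed.

Lemma fmeanD f g A B :
  fmean f A B + fmean g A B = fmean (fun x => f x + g x) A B.
Proof. by rewrite /fmean -mulmxDl -mulmxDr mxfunD. Qed.

Lemma fmeanZ c f A B : c%:C *: fmean f A B = fmean (fun x => c * f x) A B.
Proof. by rewrite /fmean scalemxAl scalemxAr mxfunZ. Qed.

Lemma fmeanB f g A B :
  fmean f A B - fmean g A B = fmean (fun x => f x - g x) A B.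
Proof.
have -> : - fmean g A B = (-1)%:C *: fmean g A B by rewrite rmorphN1 scaleN1r.
by rewrite fmeanZ fmeanD; apply: eq_fmean => x; rewrite mulN1r.
Qed.

Lemma fmean_cst1 A B : posdef A -> fmean (fun=> 1) A B = A.
Proof.
move=> pA; rewrite /fmean mxfun_cst1 mulmx1 (mxpowD _ _ pA) -[2^-1]div1r -splitr.
exact: mxpow1.
Qed.

Lemma fmean_id A B : posdef A -> posdef B -> fmean id A B = B.
Proof.
move=> pA pB.
have ab : mxpow A 2^-1 *m mxpow A (- 2^-1) = 1%:M.
  by rewrite (mxpowD _ _ pA) subrr mxpow0.
have ba : mxpow A (- 2^-1) *m mxpow A 2^-1 = 1%:M.
  by rewrite (mxpowD _ _ pA) addNr mxpow0.
have [hX _] := relmx_posdef pA pB.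
rewrite /fmean (mxfun_id hX) /relmx.
move: (mxpow A _) (mxpow A _) ab ba => P Q PQ QP.
by rewrite !mulmxA PQ mul1mx -mulmxA QP mulmx1.
Qed.

(** The difference of the two means is a congruence of [(g - f)(X)], where the
    relative matrix [X] is positive definite, so that only the values of [f]
    and [g] at positive reals matter. *)
Lemma loewner_fmean f g A B : posdef A -> posdef B ->
  (forall x, 0 < x -> f x <= g x) -> loewner_le (fmean f A B) (fmean g A B).
Proof.
move=> pA pB fg; rewrite /loewner_le fmeanB /fmean -{1}mxpow_adj.
apply/possemidef_congr/mxfun_possemidef => [|x x0]; first exact: relmx_posdef.
by rewrite subr_ge0 fg.
Qed.

End Means.

(** In the next two lemmas [F] is a real-linear map on functions, and they
    compute the image under [F] of the two sides of the scalar inequality: [f]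
    and [g] stand for the constant 1 and the identity, [p] and [q] for the
    power [v] and the square root, [h] for [fmin]. *)
Lemma young_upper_combination (R : realType) (V : lmodType R[i])
    (F : (R -> R) -> V)
    (FD : forall f g, F f + F g = F (fun x => f x + g x))
    (FZ : forall c f, c%:C *: F f = F (fun x => c * f x)) v f g :
  (1 - v)%:C *: F f + v%:C *: F g = F (fun x => (1 - v) * f x + v * g x).
Proof. by rewrite !FZ FD. Qed.

Lemma young_lower_combination (R : realType) (V : lmodType R[i])
    (F : (R -> R) -> V)
    (FD : forall f g, F f + F g = F (fun x => f x + g x))
    (FB : forall f g, F f - F g = F (fun x => f x - g x))
    (FZ : forall c f, c%:C *: F f = F (fun x => c * f x)) r a p f g q h :
  F p + r%:C *: (F f + F g - 2%:C *: F q) + a%:C *: F h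
  = F (fun x => p x + r * (f x + g x - 2 * q x) + a * h x).
Proof. by rewrite !(FZ, FD, FB). Qed.

(** * The inequalities between matrix means *)

Theorem theorem12 (R : realType) (d : nat) (A B : 'M[R[i]]_d) (v : R)
    (hA : posdef A) (hB : posdef B) (hv0 : 0 <= v) (hv1 : v <= 1) :
  [/\ loewner_le
        (gmean v A B + (r0 v)%:C *: (A + B - 2 *: gmean 2^-1 A B)
           + (alpha v)%:C *: fmean (@fmin R) A B)
        (amean v A B),
      loewner_le
        (amean v A B)
        (A + B - gmean (1 - v) A B
           - (r0 v)%:C *: (A + B - 2 *: gmean 2^-1 A B)
           - (alpha v)%:C *: fmean (@fmin R) A B)
    & A + B - gmean (1 - v) A B
        - (r0 v)%:C *: (A + B - 2 *: gmean 2^-1 A B)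
        - (alpha v)%:C *: fmean (@fmin R) A B
      = 2 *: gmean 2^-1 A B - gmean (1 - v) A B
        + (R0 v)%:C *: (A + B - 2 *: gmean 2^-1 A B)
        - (alpha v)%:C *: fmean (@fmin R) A B].
Proof.
have c2 : 2 = 2%:C :> R[i] by rewrite rmorph_nat.
have youngE w : 0 <= w <= 1 -> loewner_le
    (gmean w A B + (r0 w)%:C *: (A + B - 2 *: gmean 2^-1 A B)
      + (alpha w)%:C *: fmean (@fmin R) A B) (amean w A B).
  move=> w01.
  suff : loewner_le
      (fmean (fun x => x `^ w) A B
        + (r0 w)%:C *: (fmean (fun=> 1) A B + fmean id A B
                        - 2%:C *: fmean (fun x => x `^ 2^-1) A B)
        + (alpha w)%:C *: fmean (@fmin R) A B)
      ((1 - w)%:C *: fmean (fun=> 1) A B + w%:C *: fmean id A B).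
    by rewrite (fmean_cst1 _ hA) (fmean_id hA hB) -c2.
  pose F f := fmean f A B.
  have FD f g : F f + F g = F (fun x => f x + g x) := fmeanD f g A B.
  have FB f g : F f - F g = F (fun x => f x - g x) := fmeanB f g A B.
  have FZ c f : c%:C *: F f = F (fun x => c * f x) := fmeanZ c f A B.
  rewrite -/(F _).
  rewrite (young_upper_combination FD FZ) (young_lower_combination FD FB FZ).
  apply: loewner_fmean => // x x0.
  by have := refined_young_fmin w01 x0; rewrite mulr1.
split.
- by apply: youngE; rewrite hv0.
- (* The upper bound minus the mean of weight [v] is the mean of weight [1 - v]
     minus the lower bound of weight [1 - v]. *)
  have r0C : r0 (1 - v) = r0 v by rewrite /r0 subKr minC.
  have alphaC : alpha (1 - v) = alpha v.
    by rewrite /alpha r0C subKr -!mulrA [v * (1 - v)]mulrC.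
  have := youngE (1 - v); rewrite r0C alphaC subr_ge0 hv1 gerBl hv0 /loewner_le.
  move=> /(_ isT); congr (possemidef _).
  have -> : amean (1 - v) A B = A + B - amean v A B.
    rewrite /amean subKr rmorphB !scalerBl !scale1r opprD opprB.
    by rewrite [RHS]addrACA [A + _]addrC subrK.
  move: (amean v A B) (gmean (1 - v) A B) (_ *: _) (_ *: fmean _ _ _).
  move: (A + B) => S M G D F.
  by rewrite !opprD !addrA; do 3 (rewrite [RHS]addrAC; congr (_ + _)).
- have -> : (R0 v)%:C = 1 - (r0 v)%:C by rewrite rmorphB.
  rewrite scalerBl scale1r.
  move: (2 *: _) (gmean _ _ _) (_ *: fmean _ _ _) => G H F.
  have -> : A + B - H = G - H + (A + B - G).
    by rewrite [RHS]addrC addrA subrK.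
  by move: (A + B - G) => D; rewrite addrA.
Qed.
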